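(* Assume that $\sigma(B)\subset[\delta,\infty)$ for some $\delta>0$. Let $H=\Lambda iJ\Lambda$ with domain $$D(H)=\{X\in\mathcal V:\ J\Lambda X\in\mathcal V\}.$$ Then $D(H)$ is dense in $\mathcal X$ and the operator $H$ is selfadjoint in $\mathcal X$.
   Context: $\mathcal X$ is a complex Hilbert space; $B$ is a selfadjoint operator in $\mathcal X$ with dense domain $D(B)$; $J$ is a bounded linear operator in $\mathcal X$ with $J^*=-J$ and $J^2=-1$. $\Lambda:=B^{1/2}$ is the positive square root, and $\mathcal V:=D(\Lambda)$ is endowed with the norm $\Vert X\Vert_{\mathcal V}=\Vert\Lambda X\Vert_{\mathcal X}$. *)

(* Defs.v *)
From HB Require Import structures.
From mathcomp Require Import all_boot all_order all_algebra.
From mathcomp Require Export complex sesquilinear.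
From mathcomp Require Import all_classical all_reals all_analysis.

Set Implicit Arguments.
Unset Strict Implicit.
Unset Printing Implicit Defensive.

Import Order.TTheory GRing.Theory Num.Theory.
Import numFieldNormedType.Exports.

Local Open Scope classical_set_scope.
Local Open Scope ring_scope.

(* A Hilbert space is a complete normed space X over R[i] with a positive      *)
(* definite hermitian form, linear in its first argument, that induces the     *)
(* norm of X.                                                                  *)
Definition induces_norm (R : realType) (X : completeNormedModType R[i])
    (dot : {dot X for Num.conj}) : Prop :=
  forall x : X, `|x| ^+ 2 = dot x x.

(* Linear operators defined on a subspace. The values of opfun outside opdom   *)
(* carry no meaning, so operators are compared through their graphs.           *)
Record operator (K : numFieldType) (X : normedModType K) := Operator {
  opdom : set X ;
  opfun :> X -> X ;
  opdom0 : opdom 0 ;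
  opdomP : forall (a : K) (x y : X), opdom x -> opdom y -> opdom (a *: x + y) ;
  opfunP : forall (a : K) (x y : X), opdom x -> opdom y ->
    opfun (a *: x + y) = a *: opfun x + opfun y
}.

Section Operators.
Variables (K : numFieldType) (X : normedModType K).
Implicit Type A : operator X.

Definition opgraph A : set (X * X) := [set p | opdom A p.1 /\ A p.1 = p.2].

Lemma opfun0 A : A 0 = 0.
Proof.
have := opfunP 1 (opdom0 A) (opdom0 A).
by rewrite !scale1r addr0 => /(congr1 (fun u => u - A 0)); rewrite subrr addrK.
Qed.

Section Composition.
Variables A A' : operator X.

Let compdom : set X := [set x | opdom A' x /\ opdom A (A' x)].

Let compdom0 : compdom 0.
Proof. by split; [exact: opdom0|rewrite opfun0; exact: opdom0]. Qed.

Let compdomP (a : K) (x y : X) :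
  compdom x -> compdom y -> compdom (a *: x + y).
Proof.
move=> [x1 x2] [y1 y2]; split; first exact: opdomP.
by rewrite opfunP//; exact: opdomP.
Qed.

Let compfunP (a : K) (x y : X) : compdom x -> compdom y ->
  A (A' (a *: x + y)) = a *: A (A' x) + A (A' y).
Proof. by move=> [x1 x2] [y1 y2]; rewrite !opfunP. Qed.

Definition opcomp : operator X :=
  @Operator K X compdom (fun x => A (A' x)) compdom0 compdomP compfunP.

End Composition.

End Operators.

Section HilbertOperators.
Variables (R : realType) (X : completeNormedModType R[i]).
Variable dot : {dot X for Num.conj}.
Implicit Type A : operator X.

Definition bounded_op (T : X -> X) : Prop :=
  exists M : R, forall x : X, `|T x| <= (M%:C)%C * `|x|.

(* T' = T^* for everywhere defined bounded T and T' *)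
Definition is_adjoint (T T' : X -> X) : Prop :=
  forall x y : X, dot (T x) y = dot x (T' y).

(* (y, z) is in the graph of A^* iff <A x, y> = <x, z> for all x in D(A); this *)
(* is the graph of a function when D(A) is dense.                              *)
Definition adjoint_graph A : set (X * X) :=
  [set p | forall x : X, opdom A x -> dot (A x) p.1 = dot x p.2].

Definition selfadjoint A : Prop :=
  dense (opdom A) /\ opgraph A = adjoint_graph A.

Definition positive_op A : Prop :=
  forall x : X, opdom A x -> 0 <= dot (A x) x.

Definition is_positive_sqrt A B : Prop :=
  [/\ selfadjoint A, positive_op A & opgraph (opcomp A A) = opgraph B].

(* z such that A - z is a bijection from D(A) onto X with bounded inverse S *)
Definition resolvent_set A : set R[i] :=
  [set z | exists S : {linear X -> X}, [/\ bounded_op S,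
      forall y : X, opdom A (S y) /\ A (S y) - z *: S y = y &
      forall x : X, opdom A x -> S (A x - z *: x) = x]].

Definition spectrum A : set R[i] := ~` resolvent_set A.

Section SandwichOperator.
Variables (L : operator X) (J : {linear X -> X}).

Let sdom : set X := [set x | opdom L x /\ opdom L (J (L x))].

Let sfun (x : X) : X := L ('i%C *: J (L x)).

Let sdom0 : sdom 0.
Proof.
by split; rewrite ?opfun0 ?linear0; exact: opdom0.
Qed.

Let sdomP (a : R[i]) (x y : X) : sdom x -> sdom y -> sdom (a *: x + y).
Proof.
move=> [x1 x2] [y1 y2]; split; first exact: opdomP.
by rewrite opfunP// linearP; exact: opdomP.
Qed.

Let sfunP (a : R[i]) (x y : X) : sdom x -> sdom y ->
  sfun (a *: x + y) = a *: sfun x + sfun y.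
Proof.
move=> [x1 x2] [y1 y2]; rewrite /sfun opfunP// linearP scalerDr scalerA mulrC.
have Z z : opdom L z -> opdom L ('i%C *: z).
  by move=> Lz; rewrite -[_ *: z]addr0; apply: opdomP => //; exact: opdom0.
by rewrite -scalerA opfunP//; exact: Z.
Qed.

Definition sandwich : operator X :=
  @Operator _ X sdom sfun sdom0 sdomP sfunP.

End SandwichOperator.

End HilbertOperators.

(* Main.v *)
Require Import Defs.
From HB Require Import structures.
From mathcomp Require Import all_boot all_order all_algebra.
From mathcomp Require Import all_classical all_reals all_analysis.

Import Order.TTheory GRing.Theory Num.Theory.
Import numFieldNormedType.Exports.

Local Open Scope classical_set_scope.
Local Open Scope ring_scope.

(* Since 0 lies in the resolvent set of B = L^2, the operator L is a symmetric *)
(* bijection from D(L) onto X whose inverse G is bounded:                      *)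
(* |G y|^2 = <B^-1 y, y>. As (iJ)^2 = 1, the operator H = L (iJ) L is the      *)
(* inverse of the everywhere defined symmetric operator T = G (iJ) G. Its      *)
(* domain, the range of T, is dense because G and iJ are continuous with dense *)
(* range; and a densely defined inverse of an everywhere defined symmetric     *)
(* operator is selfadjoint.                                                    *)

(** The spectral gap enters as boundedness of B^-1, which [bounded_op_sqrt] passes on to G = L B^-1.
    Continuity of G and J gives the density of the domain; the rest is algebra with inverses, closed
    by [selfadjoint_inverse]. *)

Lemma dense_image_continuous (T U : topologicalType) (f : T -> U) (A : set T) :
  continuous f -> dense (range f) -> dense A -> dense (f @` A).
Proof.
move=> cf df dA O O0 oO; have [y [Oy [x _ xy]]] := df O O0 oO.
have [a [Ofa Aa]] : (f @^-1` O `&` A) !=set0.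
  apply: dA; last by move/continuousP: cf; exact.
  by exists x; rewrite /preimage/= xy.
by exists (f a); split => //; exists a.
Qed.

Lemma surjective_dense_range (T : Type) (U : topologicalType) (f : T -> U) :
  (forall y, exists x, f x = y) -> dense (range f).
Proof.
move=> fs O [y Oy] _; have [x fx] := fs y.
by exists y; split => //; exists x.
Qed.

Section Hilbert.
Variables (R : realType) (X : completeNormedModType R[i]).
Variable dot : {dot X for Num.conj}.

Lemma bounded_op_continuous (T : {linear X -> X}) :
  bounded_op T -> continuous T.
Proof.
move=> [M TM]; apply/linear_bounded_continuous/linear_boundedP.
exists (M%:C)%C; split; first by rewrite complex_real.
by move=> r Mr x; apply: le_trans (TM x) _; rewrite ler_wpM2r// ltW.
Qed.

Lemma dot_injr (x y : X) : (forall u, dot u x = dot u y) -> x = y.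
Proof.
move=> xy; apply/eqP; rewrite -subr_eq0 -(dnorm_eq0 dot).
by rewrite linearBr /= xy subrr.
Qed.

Lemma selfadjoint_symmetric (A : operator X) : selfadjoint dot A ->
  forall x y, opdom A x -> opdom A y -> dot (A x) y = dot x (A y).
Proof.
move=> [_ gA] x y Ax Ay.
have : opgraph A (y, A y) by [].
by rewrite gA => /(_ x Ax).
Qed.

(** Symmetry of T gives that of A. Testing a pair (y, z) of the adjoint graph on x = T u gives <u,
    y> = <T u, z> = <u, T z> for every u, hence y = T z. *)
Lemma selfadjoint_inverse (A : operator X) (T : X -> X) :
    dense (opdom A) ->
    (forall y, opdom A (T y) /\ A (T y) = y) ->
    (forall x, opdom A x -> T (A x) = x) ->
    (forall x y, dot (T x) y = dot x (T y)) ->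
  selfadjoint dot A.
Proof.
move=> dA AT TA Tsym; split=> //; apply/seteqP; split=> -[y z] /=.
  move=> [/= Ay <-] x Ax /=.
  by rewrite -{1}(TA y Ay) -Tsym TA.
move=> /= yz; have -> : y = T z.
  apply: dot_injr => u; rewrite -Tsym -yz; last exact: (AT u).1.
  by rewrite (AT u).2.
exact: AT.
Qed.

Lemma bounded_op_sqrt (S G : X -> X) : induces_norm dot ->
  bounded_op S -> (forall y, dot (G y) (G y) = dot (S y) y) -> bounded_op G.
Proof.
move=> dotn [M SM] GS; exists (M ^+ 2 + 1) => y.
set K := ((M ^+ 2 + 1)%:C)%C.
have KE : K = (M%:C)%C ^+ 2 + 1 by rewrite /K rmorphD rmorphXn rmorph1.
have M2 : 0 <= (M%:C)%C ^+ 2 :> R[i] by rewrite -rmorphXn ler0c sqr_ge0.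
have K1 : 1 <= K by rewrite KE lerDr.
have K0 : 0 <= K by exact: le_trans K1.
rewrite -(@ler_pXn2r _ 2) ?nnegrE ?mulr_ge0// exprMn.
(* <S y, y> = |G y|^2 is real, so expanding |S y - y|^2 >= 0 replaces the      *)
(* Cauchy-Schwarz inequality.                                                  *)
have dS : dot (S y) y = `|G y| ^+ 2 by rewrite dotn GS.
have Sy2 : `|G y| ^+ 2 *+ 2 <= `|S y| ^+ 2 + `|y| ^+ 2.
  have := dnorm_ge0 dot (S y - y); rewrite dnormB /= dS.
  rewrite (CrealP _) ?ger0_real ?exprn_ge0// -!dotn subr_ge0.
  by rewrite mulr2n.
have SyM : `|S y| ^+ 2 <= (M%:C)%C ^+ 2 * `|y| ^+ 2.
  rewrite -exprMn; apply: lerXn2r; rewrite ?nnegrE//.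
  exact: le_trans (SM y).
apply: (@le_trans _ _ (K * `|y| ^+ 2)); last first.
  by rewrite ler_wpM2r ?exprn_ge0// expr2 ler_peMl.
rewrite KE mulrDl mul1r; apply: le_trans (lerD SyM (lexx _)).
by apply: le_trans Sy2; rewrite mulr2n lerDl exprn_ge0.
Qed.

Lemma selfadjoint_sandwich_inverse (L : operator X) (J G : {linear X -> X}) :
    selfadjoint dot L -> bounded_op J -> is_adjoint dot J (fun x => - J x) ->
    (forall x, J (J x) = - x) ->
    bounded_op G -> (forall y, opdom L (G y) /\ L (G y) = y) ->
    (forall x, opdom L x -> G (L x) = x) ->
  selfadjoint dot (sandwich L J).
Proof.
move=> Lsa Jb Jadj Jsq Gb LG GL.
have Gsym x y : dot (G x) y = dot x (G y).
  have [Gx LGx] := LG x; have [Gy LGy] := LG y.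
  by rewrite -{1}LGy -(selfadjoint_symmetric _ Lsa)// LGx.
have dG : dense (range G).
  case: Lsa => dL _ O O0 oO; have [x [Ox Lx]] := dL O O0 oO.
  by exists x; split => //; exists (L x) => //; exact: GL.
have iZ (x : X) : 'i%C *: ('i%C *: x) = - x.
  by rewrite scalerA -expr2 sqr_i scaleN1r.
have LZ (a : R[i]) x : opdom L x -> opdom L (a *: x).
  by move=> Lx; rewrite -[_ *: x]addr0; apply: opdomP => //; exact: opdom0.
pose T x := G ('i%C *: J (G x)).
apply: (@selfadjoint_inverse _ T) => [|y|x [Lx LJx]|x y].
(* [range G] is D(L), and J^-1 = -J preserves membership in D(L) up to sign, so L x ranges over J
   D(L). *)
- have -> : opdom (sandwich L J) = G @` (J @` range G).
    apply/seteqP; split=> x /=.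
      move=> [Lx LJx]; exists (L x); last exact: GL.
      exists (- J (L x)); last by rewrite linearN Jsq opprK.
      by exists (- L (J (L x))) => //; rewrite linearN GL.
    move=> [_ [_ [u _ <-] <-] <-]; split; first exact: (LG _).1.
    rewrite (LG _).2 Jsq -scaleN1r; apply: LZ; exact: (LG _).1.
  apply: dense_image_continuous => //; first exact: bounded_op_continuous.
  apply: dense_image_continuous => //; first exact: bounded_op_continuous.
  apply: surjective_dense_range => y.
  by exists (- J y); rewrite linearN Jsq opprK.
- have JL : J (L (T y)) = - ('i%C *: G y).
    by rewrite (LG _).2 linearZ /= Jsq scalerN.
  split.
    split; first exact: (LG _).1.
    by rewrite JL -scaleNr; apply: LZ; exact: (LG _).1.
  by rewrite /= JL scalerN iZ opprK (LG _).2.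
- rewrite /T /= GL; last exact: LZ.
  by rewrite [J (_ *: _)]linearZ /= Jsq iZ opprK GL.
(* The sign from J^* = -J cancels the one from conjugating i in the second argument. *)
- rewrite /T !Gsym linearZl_LR /= Jadj.
  rewrite Gsym [G (- _)]linearN [G (_ *: _)]linearZ linearNr linearZr_LR /=.
  rewrite mulrN -mulNr; congr (_ * _).
  by apply/eqP; rewrite eq_complex /= oppr0 !eqxx.
Qed.

End Hilbert.

Theorem lemma2p1 (R : realType) (X : completeNormedModType R[i])
    (dot : {dot X for Num.conj}) (dot_norm : induces_norm dot)
    (B : operator X) (B_sa : selfadjoint dot B)
    (J : {linear X -> X}) (J_bounded : bounded_op J)
    (J_adj : is_adjoint dot J (fun x => - J x))
    (J_sq : forall x : X, J (J x) = - x)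
    (L : operator X) (L_sqrt : is_positive_sqrt dot L B)
    (delta : R) (delta_gt0 : 0 < delta)
    (B_spectrum : spectrum B `<=` [set (t%:C)%C | t in `[delta, +oo[]) :
  dense (opdom (sandwich L J)) /\ selfadjoint dot (sandwich L J).
Proof.
suff H : selfadjoint dot (sandwich L J) by split; [case: H|].
have [S [Sb BS SB]] : resolvent_set B 0.
  apply: contrapT => /B_spectrum [t /=]; rewrite in_itv /= andbT => dt.
  move=> /(congr1 (@complex.Re R)) /= t0.
  by move: (lt_le_trans delta_gt0 dt); rewrite t0 ltxx.
case: L_sqrt => Lsa _ LLB.
(* S = B^-1 maps into D(B) = D(L^2), so L S is an everywhere defined right inverse of L. *)
have LS y : [/\ opdom L (S y), opdom L (L (S y)) & L (L (S y)) = y].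
  have [BSy] := BS y; rewrite scale0r subr0 => BSyE.
  have : opgraph B (S y, y) by [].
  by rewrite -LLB => -[[]].
have Glin : linear (fun y => L (S y)).
  move=> a x y; have [Lx _ _] := LS x; have [Ly _ _] := LS y.
  by rewrite linearP opfunP.
pose G : {linear X -> X} :=
  HB.pack (fun y => L (S y)) (GRing.isLinear.Build _ _ _ _ _ Glin).
(* If L x = 0 then x lies in D(L^2) = D(B) and B x = 0. This injectivity makes G a left inverse
   too. *)
have L_eq0 x : opdom L x -> L x = 0 -> x = 0.
  move=> Lx Lx0; have : opgraph (opcomp L L) (x, 0).
    by split; [split => //=; rewrite Lx0; exact: opdom0|rewrite /= Lx0 opfun0].
  rewrite LLB => -[/= Bx Bx0].
  by rewrite -(SB x Bx) Bx0 scale0r subr0 linear0.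
have LG y : opdom L (G y) /\ L (G y) = y by have [] := LS y.
apply: (@selfadjoint_sandwich_inverse _ _ dot L J G) => //.
  apply: (@bounded_op_sqrt _ _ dot S G) => // y.
  have [LSy LLSy LLSyE] := LS y.
  by rewrite (selfadjoint_symmetric _ _ _ _ Lsa)//= LLSyE.
move=> x Lx; have [LGx LGxE] := LG (L x).
apply/eqP; rewrite -subr_eq0 -[- x]scaleN1r addrC; apply/eqP/L_eq0.
  exact: opdomP.
by rewrite opfunP// LGxE scaleN1r addNr.
Qed.
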